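(* Let $m:\mathbb{N}\to\mathbb{N}$ be any function with $m(n) = n^{1+o(1)}$, and let $\mathcal{S}_n$ denote the family of unweighted graphs on $n$ nodes with at most $m(n)$ edges. Then there exists a distance labeling scheme for $\mathcal{S}_n$ whose maximum label size is $o(n)$ (as $n\to\infty$).
   Context: A distance labeling scheme for a family of graphs $\mathcal G$ consists of an encoder and a decoder $d$. Given $G\in\mathcal G$, the encoder computes a label assignment $e_G:V(G)\to\{0,1\}^*$. The decoder is a single function (not depending on $G$) such that for every $G\in\mathcal G$ and every $u,v\in V(G)$, $d(e_G(u),e_G(v)) = dist_G(u,v)$, the shortest-path distance (number of edges). The size of the scheme is the maximum of $|e_G(u)|$ over all $G\in\mathcal G$ and $u\in V(G)$. Graphs are unweighted; the paper states its results for both undirected and directed graphs (for directed graphs $dist_G$ is the directed shortest-path distance). *)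

(* Defs.v *)
From mathcomp Require Import all_boot.
Set Implicit Arguments. Unset Strict Implicit. Unset Printing Implicit Defensive.

(* m(n) = n^{1+o(1)}: for every eps = 1/k > 0, eventually
   n^{1-1/k} <= m(n) <= n^{1+1/k}, i.e. n^(k-1) <= m(n)^k <= n^(k+1). *)
Definition growth_n_1_plus_o1 (m : nat -> nat) : Prop :=
  forall k : nat, 0 < k -> exists N : nat, forall n : nat, N <= n ->
    n ^ (k - 1) <= m n ^ k /\ m n ^ k <= n ^ (k + 1).

Definition little_o_n (f : nat -> nat) : Prop :=
  forall k : nat, 0 < k -> exists N : nat, forall n : nat, N <= n -> k * f n <= n.

Definition walk_of_length {T : finType} (e : rel T) (k : nat) (u v : T) : Prop :=
  exists p : seq T, [/\ path e u p, last u p = v & size p = k].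

Definition is_dist {T : finType} (e : rel T) (u v : T) (o : option nat) : Prop :=
  match o with
  | Some k => walk_of_length e k u v /\ (forall j, j < k -> ~ walk_of_length e j u v)
  | None => forall k, ~ walk_of_length e k u v
  end.

Definition dgraph_in_family (mn : nat) (n : nat) (e : rel 'I_n) : Prop :=
  irreflexive e /\ #|[set p : 'I_n * 'I_n | e p.1 p.2]| <= mn.

Definition ugraph_in_family (mn : nat) (n : nat) (e : rel 'I_n) : Prop :=
  irreflexive e /\ symmetric e /\
  #|[set p : 'I_n * 'I_n | e p.1 p.2 && (p.1 < p.2)]| <= mn.

Definition labeling_scheme_with_size
    (fam : forall n : nat, rel 'I_n -> Prop) (L : nat -> nat) : Prop :=
  exists (d : nat -> seq bool -> seq bool -> option nat)
         (enc : forall n : nat, rel 'I_n -> 'I_n -> seq bool),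
    forall (n : nat) (e : rel 'I_n), fam n e ->
      forall u v : 'I_n,
        is_dist e u v (d n (enc n e u) (enc n e v)) /\ size (enc n e u) <= L n.

(* Main.v *)
Require Import Defs.
From mathcomp Require Import all_boot.
From Stdlib Require Import ClassicalEpsilon.
From mathcomp Require Import zify.
Set Implicit Arguments. Unset Strict Implicit. Unset Printing Implicit Defensive.

(* Fix a dyadic scale: the pairs at distance in [a, 4a), a = 4^i. Each of them
   has at least a vertices on geodesics, so O(i n / a) greedily chosen hubs hit
   all but a 16^-i fraction of these pairs. Promoting the vertices that still
   have more than n / a unhit partners to hubs adds at most n / a hubs, and the
   remaining unhit partners go to a sparse table. Hub distances are only stored
   up to 4a, in O(i) bits, so the scale costs O(i^2 n / 4^i) bits; the scales
   i >= i0 together cost O(n / 2^i0). This needs no sparsity and no symmetry of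
   the graph.
   For distances below the constant 4^i0 the hubs are the vertices of out-degree
   greater than K (2m / n + 1), K a large constant: at most n / K of them, and
   only n^o(1) vertices are reached within constant distance through the others.
   Directed and undirected graphs alike have at most 2m ordered edges. *)

(** * Walks, distances and vertices on geodesics *)

Section Walks.
Variables (V : finType) (e : rel V).
Implicit Types u v s : V.

Fixpoint wk k u v : bool :=
  if k is k'.+1 then [exists x, wk k' u x && e x v] else u == v.

Lemma wkP k u v : reflect (walk_of_length e k u v) (wk k u v).
Proof.
elim: k v => [|k IHk] v /=.
  apply: (iffP eqP) => [->|[p [_ <- /size0nil ->]] //]; by exists [::].
apply: (iffP existsP) => [[x /andP[/IHk[p [ep <- <-]] exv]]|[p [ep lp sp]]].
  by exists (rcons p v); rewrite rcons_path ep exv last_rcons size_rcons.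
case/lastP: p ep lp sp => // p y; rewrite rcons_path last_rcons size_rcons.
case/andP=> ep ey <- [sp]; exists (last u p); rewrite ey andbT.
by apply/IHk; exists p.
Qed.

Lemma wk_cat a b u v :
  wk (a + b) u v = [exists s, wk a u s && wk b s v].
Proof.
elim: b v => [|b IHb] v.
  rewrite addn0; apply/idP/existsP => [w|[s /andP[w /eqP <-]] //].
  by exists v; rewrite w /=.
rewrite addnS /=; apply/existsP/existsP;
  last case=> s /andP[ws /existsP[x /andP[wx exv]]]; first case=> x.
  rewrite IHb => /andP[/existsP[s /andP[ws wx]] exv].
  by exists s; rewrite ws; apply/existsP; exists x; rewrite wx.
by exists x; rewrite exv andbT IHb; apply/existsP; exists s; rewrite ws.
Qed.

Lemma wk_trans a b s u v : wk a u s -> wk b s v -> wk (a + b) u v.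
Proof. by move=> wa wb; rewrite wk_cat; apply/existsP; exists s; rewrite wa. Qed.

Definition isd k u v := wk k u v && [forall j : 'I_k, ~~ wk j u v].

Lemma isd_wk k u v : isd k u v -> wk k u v.
Proof. by case/andP. Qed.

Lemma isd_min k j u v : isd k u v -> wk j u v -> k <= j.
Proof.
case/andP=> _ /forallP H wj; rewrite leqNgt; apply/negP => lt_jk.
by have := H (Ordinal lt_jk); rewrite /= wj.
Qed.

Lemma isdI k u v : wk k u v -> (forall j, wk j u v -> k <= j) -> isd k u v.
Proof.
move=> w H; rewrite /isd w; apply/forallP => j; apply/negP => /H.
by rewrite leqNgt ltn_ord.
Qed.

Lemma isd_inj k k' u v : isd k u v -> isd k' u v -> k = k'.
Proof.
move=> d d'; apply/eqP; rewrite eqn_leq.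
by rewrite (isd_min d (isd_wk d')) (isd_min d' (isd_wk d)).
Qed.

Lemma wk_isd k u v : wk k u v -> exists2 j, j <= k & isd j u v.
Proof.
move=> w; have ex : exists k, wk k u v by exists k.
by case: (ex_minnP ex) => j wj H; exists j; [exact: H | exact: isdI].
Qed.

(** The vertices on shortest walks from [u] to [v]; the set is empty when the distance is not below
    [c]. *)
Definition geo c u v : {set V} :=
  [set s | [exists k : 'I_c, isd k u v &&
             [exists a : 'I_k.+1, wk a u s && wk (k - a) s v]]].

Lemma mem_geo c k u v s : isd k u v ->
  s \in geo c u v -> exists a b, [/\ a + b = k, isd a u s & isd b s v].
Proof.
move=> dk; rewrite inE => /existsP[k' /andP[/(isd_inj dk) <-]].
case/existsP=> a /andP[wa wb]; have ak : a <= k by rewrite -ltnS.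
exists a, (k - a); split; first exact: subnKC.
  by apply: isdI => // j wj; have := isd_min dk (wk_trans wj wb); lia.
by apply: isdI => // j wj; have := isd_min dk (wk_trans wa wj); lia.
Qed.

(** For each [a <= k] a vertex at position [a] of some geodesic is chosen. The choices need not
    share a geodesic, yet if [f a = f b], then [b] steps to this vertex and [k - a] steps from it
    reach [v]; minimality of [k] gives [a <= b]. *)
Lemma card_geo c k u v : k < c -> isd k u v -> k < #|geo c u v|.
Proof.
move=> kc dk.
have P (a : 'I_k.+1) : exists s, wk a u s && wk (k - a) s v.
  by apply/existsP; rewrite -wk_cat subnKC ?isd_wk // -ltnS.
pose f a := xchoose (P a).
have fP (a : 'I_k.+1) : wk a u (f a) && wk (k - a) (f a) v := xchooseP (P a).
have f_le (a b : 'I_k.+1) : f a = f b -> a <= b.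
  have /andP[_ wa] := fP a; have /andP[wb _] := fP b => fab.
  rewrite fab in wa; have := isd_min dk (wk_trans wb wa).
  by have := ltn_ord a; lia.
have f_inj : injective f.
  by move=> a b fab; apply/val_inj/eqP; rewrite eqn_leq !f_le.
rewrite -[k.+1]card_ord -(card_image f_inj).
apply/subset_leq_card/subsetP => _ /codomP[a ->].
rewrite inE; apply/existsP; exists (Ordinal kc).
by rewrite dk; apply/existsP; exists a; apply: fP.
Qed.

Lemma isd_lt_card k u v : isd k u v -> k < #|V|.
Proof. by move/(card_geo (ltnSn k))/leq_trans; apply; apply: max_card. Qed.

End Walks.

(** * Greedy hitting sets *)

Section Hitting.
Variables (V X : finType) (P : X -> {set V}).

Definition unhit (F : {set X}) (S : {set V}) :=
  [set x in F | S \subset ~: P x].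

(** Double counting of the pairs with [s \in P x]: the best vertex does at least as well as the
    average one. *)
Lemma popular_vertex (F : {set X}) D :
  F != set0 -> (forall x, x \in F -> D <= #|P x|) -> 0 < D ->
  exists s, D * #|F| <= #|V| * #|[set x in F | s \in P x]|.
Proof.
move=> F0 FD D0; case/set0Pn: (F0) => x0 x0F.
have /card_gt0P[s0 _] := leq_trans D0 (FD _ x0F).
pose f s := #|[set x in F | s \in P x]|.
case: (@arg_maxnP V s0 predT f isT) => s _ smax; exists s.
have -> : D * #|F| = \sum_(x in F) D by rewrite sum_nat_const mulnC.
apply: (@leq_trans (\sum_(x in F) #|P x|)); first by apply: leq_sum.
have -> : \sum_(x in F) #|P x| = \sum_s f s.
  rewrite (eq_bigr (fun x => \sum_s (s \in P x : nat))); last first.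
    move=> x _; rewrite -sum1_card big_mkcond /=.
    by apply: eq_bigr => y _; case: (y \in _).
  rewrite exchange_big /=; apply: eq_bigr => y _; rewrite /f -sum1_card.
  rewrite big_mkcond [RHS]big_mkcond /=; apply: eq_bigr => x _; rewrite inE.
  by case: (x \in F); case: (y \in P x).
by rewrite -sum_nat_const; apply: leq_sum => y _; apply: smax.
Qed.

Lemma half_hitting (F : {set X}) D :
  (forall x, x \in F -> D <= #|P x|) -> 0 < D ->
  exists2 S : {set V}, #|S| <= (#|V| %/ D).+1 & 2 * #|unhit F S| <= #|F|.
Proof.
move=> FD D0.
(* While more than half of [F] is unhit, a popular vertex hits at least D |F| / (2 |V|) further
   members. The second alternative records this progress; once [t * D >= #|V|] it implies the
   first. *)
have greedy t : exists2 S : {set V}, #|S| <= t &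
    2 * #|unhit F S| <= #|F| \/
    t * D * #|F| + 2 * #|V| * #|unhit F S| <= 2 * #|V| * #|F|.
  elim: t => [|t [S St IH]].
    exists set0; rewrite ?cards0 //; right; rewrite !mul0n add0n leq_mul2l.
    by rewrite subset_leq_card ?orbT //; apply/subsetP => x; rewrite inE => /andP[].
  have [done|big] := leqP (2 * #|unhit F S|) #|F|.
    by exists S; [exact: leqW | left].
  case: IH => [|IH]; first by lia.
  have U0 : unhit F S != set0 by rewrite -card_gt0; lia.
  have [x|s sP] := popular_vertex U0 (D := D) _ D0.
    by rewrite inE => /andP[/FD].
  exists (s |: S); first by rewrite cardsU1; case: (s \notin S) => /=; lia.
  right.
  have E : #|unhit F S| =
      #|unhit F (s |: S)| + #|[set x in unhit F S | s \in P x]|.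
    rewrite addnC -(cardsID [set x | s \in P x]); congr (_ + _); apply: eq_card => x.
      by rewrite !inE.
    by rewrite !inE subUset sub1set !inE andbCA.
  nia.
have [S Sc [//|H]] := greedy (#|V| %/ D).+1; first by exists S.
exists S => //; have := ltn_ceil #|V| D0 => H1.
have [V0|V0] := posnP #|V|.
  have -> : #|F| = 0.
    apply/eqP; rewrite cards_eq0; apply/set0Pn => -[x /FD].
    by have := max_card (P x); rewrite -[#|xpredT|]/#|V|; lia.
  suff -> : unhit F S = set0 by rewrite cards0.
  apply/eqP/set0Pn => -[x]; rewrite inE => /andP[/FD + _].
  by have := max_card (P x); rewrite -[#|xpredT|]/#|V|; lia.
have : #|V| * #|F| <= (#|V| %/ D).+1 * D * #|F| by rewrite leq_mul2r ltnW ?orbT.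
by move=> H2; rewrite -(leq_pmul2l V0); nia.
Qed.

Lemma unhitU F S S' : unhit F (S :|: S') = unhit (unhit F S) S'.
Proof. by apply/setP => x; rewrite !inE subUset andbA. Qed.

Lemma pow_hitting (F : {set X}) D j :
  (forall x, x \in F -> D <= #|P x|) -> 0 < D ->
  exists2 S : {set V}, #|S| <= j * (#|V| %/ D).+1 & 2 ^ j * #|unhit F S| <= #|F|.
Proof.
move=> FD D0; elim: j => [|j [S Sc H]].
  exists set0; rewrite ?cards0 // mul1n subset_leq_card //.
  by apply/subsetP => x; rewrite inE => /andP[].
have [x|S' S'c H'] := half_hitting (F := unhit F S) _ D0.
  by rewrite inE => /andP[/FD].
exists (S :|: S').
  by apply: leq_trans (leq_card_setU _ _) _; rewrite mulSn addnC leq_add.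
rewrite unhitU expnSr -mulnA; apply: leq_trans H.
by rewrite leq_mul2l H' orbT.
Qed.

End Hitting.

(** * Counting sparse tables *)

Lemma expn_mono a b n : a <= b -> a ^ n <= b ^ n.
Proof. by case: n => // n ab; rewrite leq_exp2r. Qed.

(** Bernoulli's inequality (1 - 1/(M+1))^r >= 1 - r/(M+1) >= 1/2, cleared of denominators. *)
Lemma expS_le_double M r : 2 * r <= M.+1 -> M.+1 ^ r <= 2 * M ^ r.
Proof.
have bernoulli j : j <= M.+1 -> (M.+1 - j) * M.+1 ^ j <= M.+1 * M ^ j.
  elim: j => [|j IHj] jM; first by rewrite !expn0 subn0.
  have IH := IHj (ltnW jM).
  apply: (@leq_trans (M * ((M.+1 - j) * M.+1 ^ j))).
    by rewrite expnS !mulnA leq_mul2r; apply/orP; right; nia.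
  by rewrite expnS (mulnCA M.+1) leq_mul2l IH orbT.
move=> rM; have := bernoulli r ltac:(lia).
move=> H; have : M.+1 * M.+1 ^ r <= M.+1 * (2 * M ^ r) by nia.
by rewrite leq_pmul2l.
Qed.

Lemma expS_le_pow2 M r n : 0 < r -> 2 * r <= M.+1 ->
  M.+1 ^ n <= 2 ^ (n %/ r).+1 * M ^ n.
Proof.
move=> r0 rM; set a := n %/ r; set b := n %% r.
have b_r : b < r by rewrite ltn_pmod.
have Hr := expS_le_double rM.
have Hb : M.+1 ^ b <= 2 * M ^ b by apply: expS_le_double; lia.
have Ha : (M.+1 ^ r) ^ a <= (2 * M ^ r) ^ a by apply: expn_mono.
rewrite (divn_eq n r) -/a -/b [a * r]mulnC !expnD !expnM.
apply: leq_trans (leq_mul Ha Hb) _.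
by rewrite expnMn mulnACA -expnSr.
Qed.

Section SparseTables.
Variables (V : finType) (c t : nat).

Definition table_support (f : {ffun V -> option 'I_c}) := [set v | f v != None].

Definition sparse_table := {f : {ffun V -> option 'I_c} | #|table_support f| <= t}.

Lemma card_sparse_table M r w : 0 < c -> 0 < M -> 0 < r -> 2 * r <= M.+1 ->
  M * c <= 2 ^ w -> #|{: sparse_table}| <= 2 ^ (t * w + (#|V| %/ r).+1).
Proof.
move=> c0 M0 r0 rM Mw; set n := #|V|.
(* Weight each function by (M c)^#None: the total weight is (c (M + 1))^n, while
   each sparse table has weight at least (M c)^(n - t). *)
pose wt (o : option 'I_c) := if o is None then M * c else 1.
have sumwt : \sum_o wt o = c * M.+1.
  rewrite (bigD1 None) //= (eq_bigr (fun _ => 1)) => [|[]] //.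
  rewrite sum1_card -[#|_|]/#|predC1 None| cardC1 card_option card_ord /=.
  by rewrite mulnS addnC mulnC.
have prodwt (f : {ffun V -> option 'I_c}) : #|table_support f| <= t ->
    (M * c) ^ (n - t) <= \prod_v wt (f v).
  move=> ft; rewrite (bigID (mem (table_support f))) /=.
  rewrite big1 ?mul1n => [|v]; last by rewrite inE; case: (f v).
  rewrite (eq_bigr (fun _ => M * c)) => [|v]; last by rewrite inE; case: (f v).
  rewrite prod_nat_const leq_pexp2l ?muln_gt0 ?M0 // -/n.
  rewrite leq_subLR /n -(cardC (mem (table_support f))) leq_add2r.
  exact: ft.
have count : #|{: sparse_table}| * (M * c) ^ (n - t) <= (c * M.+1) ^ n.
  rewrite card_sig -sum_nat_const -sumwt -prod_nat_const bigA_distr_bigA /=.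
  rewrite [leqRHS](bigID (fun f => #|table_support f| <= t)) /=.
  apply: leq_trans (leq_addr _ _).
  by apply: leq_sum => f; apply: prodwt.
(* The number of tables is at most (M c)^t ((M + 1) / M)^n; the first factor costs [t * w] bits, the
   second [(n %/ r).+1]. *)
rewrite -(@leq_pmul2r ((M * c) ^ n)) ?expn_gt0 ?muln_gt0 ?M0 ?c0 //.
apply: (@leq_trans (#|{: sparse_table}| * (M * c) ^ (n - t) * (M * c) ^ t)).
  rewrite -mulnA leq_mul2l -expnD leq_pexp2l ?orbT ?muln_gt0 ?M0 //; lia.
apply: leq_trans (leq_mul count (leqnn _)) _.
rewrite expnD mulnC -mulnA; apply: leq_mul.
  by rewrite (mulnC t) expnM expn_mono.
rewrite !expnMn [leqRHS]mulnA [leqRHS]mulnC leq_mul2l; apply/orP; right.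
exact: expS_le_pow2.
Qed.

End SparseTables.

(** * Labels in finite types, and hub labels *)

Section Schemes.
Variables (V : finType) (fam : rel V -> Prop).

(* [d u v x y k] says that [k] is a candidate length read off the labels [x] of
   [u] and [y] of [v]; the true distance is the least candidate. *)
Definition scheme (Q : nat -> Prop) (s : nat) : Prop :=
  exists (T : finType) (d : V -> V -> T -> T -> nat -> bool),
    #|T| <= 2 ^ s /\
    forall e, fam e -> exists lab : V -> T, forall u v k,
      (d u v (lab u) (lab v) k -> wk e k u v) /\
      (isd e k u v -> Q k -> d u v (lab u) (lab v) k).

Lemma scheme_union (Q1 Q2 Q : nat -> Prop) s1 s2 s :
  (forall k, Q k -> Q1 k \/ Q2 k) -> s1 + s2 <= s ->
  scheme Q1 s1 -> scheme Q2 s2 -> scheme Q s.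
Proof.
move=> Q12 s12 [T1 [d1 [c1 H1]]] [T2 [d2 [c2 H2]]].
exists (T1 * T2)%type, (fun u v x y k => d1 u v x.1 y.1 k || d2 u v x.2 y.2 k).
split.
  rewrite card_prod; apply: leq_trans (leq_mul c1 c2) _.
  by rewrite -expnD leq_pexp2l.
move=> e fe; have [l1 L1] := H1 e fe; have [l2 L2] := H2 e fe.
exists (fun u => (l1 u, l2 u)) => u v k /=.
have [S1 C1] := L1 u v k; have [S2 C2] := L2 u v k.
split=> [/orP[/S1|/S2] //|dk /Q12[q|q]]; first by rewrite C1.
by rewrite C2 ?orbT.
Qed.

Definition missed (e : rel V) a c (S : {set V}) u : {set V} :=
  [set v | [exists k : 'I_c, (a <= k) && isd e k u v] & S \subset ~: geo e c u v].

Lemma hub_scheme a c h t w M r w' :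
  0 < c -> c < 2 ^ w -> 0 < M -> 0 < r -> 2 * r <= M.+1 -> M * c <= 2 ^ w' ->
  (forall e, fam e -> exists2 S : {set V}, #|S| <= h &
     forall u, #|missed e a c S u| <= t) ->
  scheme (fun k => a <= k < c) (2 * h * w + (t * w' + (#|V| %/ r).+1)).
Proof.
move=> c0 cw M0 r0 rM Mw Hhub.
pose H : finType := {ffun 'I_h -> option 'I_c}.
pose dval (e : rel V) u v : option 'I_c := [pick k : 'I_c | isd e k u v].
have dvalP (e : rel V) u v k : dval e u v = Some k -> isd e k u v.
  by rewrite /dval; case: pickP => // x dx [<-].
have dvalE (e : rel V) u v (k : 'I_c) : isd e k u v -> dval e u v = Some k.
  rewrite /dval; case: pickP => [x dx dk|/(_ k) -> //].
  by congr Some; apply/val_inj/(isd_inj dx dk).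
exists (H * H * sparse_table V c t)%type.
exists (fun u v (x y : H * H * sparse_table V c t) k =>
  [exists i, exists p : 'I_c, exists q : 'I_c,
     [&& x.1.1 i == Some p, y.1.2 i == Some q & p + q == k]]
  || (omap val (val x.2 v) == Some k)).
split.
  rewrite !card_prod !card_ffun !card_option !card_ord expnD; apply: leq_mul.
    by rewrite -expnD addnn -mul2n (mulnC (2 * h)) (expnM 2) expn_mono.
  exact: (card_sparse_table _ _ c0 M0 r0 rM Mw).
move=> e /Hhub[S Sh St].
(* [S] may have fewer than [h] elements; spare slots read [None]. *)
pose hub (i : 'I_h) := nth None [seq Some s | s <- enum S] i.
pose tab u : {ffun V -> option 'I_c} :=
  [ffun v => if v \in missed e a c S u then dval e u v else None].
have tabP u : #|table_support (tab u)| <= t.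
  apply: leq_trans (St u); apply/subset_leq_card/subsetP => v.
  by rewrite inE ffunE; case: ifP.
exists (fun u => ([ffun i => obind (dval e u) (hub i)],
                  [ffun i => obind (dval e ^~ u) (hub i)], exist _ (tab u) (tabP u))).
move=> u v k /=; split.
  case/orP=> [/existsP[i /existsP[p /existsP[q]]]|/eqP].
    rewrite !ffunE; case: (hub i) => [s|] //=.
    case/and3P=> /eqP/dvalP/isd_wk us /eqP/dvalP/isd_wk sv /eqP <-.
    exact: wk_trans us sv.
  rewrite ffunE; case: ifP => // _; case E: (dval e u v) => [p|] //= [<-].
  exact/isd_wk/dvalP.
move=> dk /andP[ak kc]; apply/orP.
have [vm|vm] := boolP (v \in missed e a c S u); [right|left].
  by rewrite ffunE vm (dvalE e u v (Ordinal kc)).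
move: vm; rewrite inE negb_and; case/orP.
  by case/existsP; exists (Ordinal kc); rewrite ak.
case/subsetPn=> s sS; rewrite inE negbK => /(mem_geo dk)[p [q [pq us sv]]].
have ih : index s (enum S) < h.
  by apply: leq_trans Sh; rewrite cardE index_mem mem_enum.
apply/existsP; exists (Ordinal ih).
have pc : p < c by lia.
have qc : q < c by lia.
apply/existsP; exists (Ordinal pc); apply/existsP; exists (Ordinal qc).
have hs : hub (Ordinal ih) = Some s.
  by rewrite /hub /= (nth_map s) ?nth_index ?index_mem ?mem_enum.
by rewrite !ffunE hs /= (dvalE _ _ _ (Ordinal pc)) //
  (dvalE _ _ _ (Ordinal qc)) // !eqxx pq eqxx.
Qed.

End Schemes.

(** * Dyadic scales of distances *)

Lemma sqr_le_pow2 i : i * i <= 2 * 2 ^ i.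
Proof.
elim: i => // i IHi; have := ltn_expl i (isT : 1 < 2).
rewrite expnS; lia.
Qed.

Section Scales.
Variable V : finType.

(** After [j] halvings at most |V|^2 / 2^j pairs are unhit, and each heavy vertex owns more than [t]
    of them. The second bound thus limits the hubs added beyond the greedy ones. *)
Lemma far_hubs (e : rel V) a c j t : 0 < a ->
  exists S : {set V}, (forall u, #|missed e a c S u| <= t) /\
    (#|S| - j * (#|V| %/ a).+1) * t.+1 * 2 ^ j <= #|V| ^ 2.
Proof.
move=> a0.
pose F : {set V * V} := [set p | [exists k : 'I_c, (a <= k) && isd e k p.1 p.2]].
pose P (p : V * V) := geo e c p.1 p.2.
have FP p : p \in F -> a <= #|P p|.
  rewrite inE => /existsP[k /andP[ak dk]].
  exact: leq_trans ak (ltnW (card_geo (ltn_ord k) dk)).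
have [S Sc Su] := pow_hitting j FP a0.
pose heavy := [set u | t < #|missed e a c S u|].
exists (S :|: heavy); split.
  move=> u; have [tu|ut] := ltnP t #|missed e a c S u|; last first.
    apply: leq_trans ut; apply/subset_leq_card/subsetP => v.
    by rewrite !inE subUset => /and3P[-> ->].
  (* A heavy [u] is itself a hub and lies on all geodesics leaving it, so it misses nothing. *)
  rewrite (_ : missed _ _ _ _ u = set0) ?cards0 //; apply/setP => v.
  rewrite !inE; apply/negbTE/negP => /andP[/existsP[k /andP[_ dk]]].
  move/subsetP/(_ u); rewrite !inE tu orbT => /(_ isT) /negP; apply.
  apply/existsP; exists k; rewrite dk; apply/existsP; exists ord0.
  by rewrite subn0 /= eqxx isd_wk.
have hc : #|heavy| * t.+1 <= #|unhit P F S|.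
  have -> : #|unhit P F S| = \sum_u #|missed e a c S u|.
    rewrite -sum1_card (eq_bigr (fun u => \sum_(v in missed e a c S u) 1)).
      by rewrite pair_big_dep /=; apply: eq_bigl => -[u v]; rewrite !inE.
    by move=> u _; rewrite sum1_card.
  rewrite -sum_nat_const big_mkcond /=; apply: leq_sum => u _.
  by rewrite inE; case: ifP.
apply: (@leq_trans (#|unhit P F S| * 2 ^ j)).
  rewrite leq_mul2r; apply/orP; right; apply: leq_trans hc.
  rewrite leq_mul2r; apply/orP; right; rewrite leq_subLR.
  by apply: leq_trans (leq_card_setU _ _) _; rewrite leq_add2r.
rewrite mulnC; apply: leq_trans Su _; apply: leq_trans (max_card _) _.
by rewrite card_prod.
Qed.

Variable fam : rel V -> Prop.

Lemma scale_scheme i : 4 ^ i <= #|V| ->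
  exists2 s, 2 ^ i * s <= 200 * #|V| &
    scheme fam (fun k => 4 ^ i <= k < 4 ^ i.+1) s.
Proof.
move=> iV; set n := #|V|; pose y := n %/ 4 ^ i.
have p0 : 0 < 4 ^ i by rewrite expn_gt0.
have y0 : 0 < y by rewrite divn_gt0.
have yn : y * 4 ^ i <= n by apply: leq_divM.
have ny : n < y.+1 * 4 ^ i by apply: ltn_ceil.
have E4 : 4 ^ i = 2 ^ i * 2 ^ i by rewrite -expnD addnn -mul2n expnM.
(* [4 * i] halvings leave at most n^2 / 16^i unhit pairs; with threshold [y] and [n < y.+1 * 4 ^ i],
   at most [y] vertices are heavy. *)
pose h := 4 * i * y.+1 + y.
exists (2 * h * (2 * i + 3) + (y * (4 * i + 3) + (n %/ 4 ^ i).+1)); last first.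
  (* With r = 4^i and this [M], M c is exactly 2^(4i+3), and the table overhead is only about n /
     4^i bits. *)
  apply: (@hub_scheme _ _ _ _ _ _ _ (2 * 4 ^ i)) => //.
  - by rewrite expn_gt0.
  - rewrite expnD (expnM 2 2) expnS -[2 ^ 2]/4 -[2 ^ 3]/8; lia.
  - by rewrite muln_gt0.
  - rewrite expnD (expnM 2 4) -[2 ^ 4]/(4 * 4) -[2 ^ 3]/8 expnMn expnS; nia.
  move=> e _; have [S [St Sc]] := far_hubs e (4 ^ i.+1) (4 * i) y p0.
  exists S => //; rewrite /h -leq_subLR -/y.
  move: Sc; rewrite -/n -/y; set x := #|S| - _.
  rewrite (expnM 2 4) -[2 ^ 4]/(4 * 4) expnMn.
  move=> Sc; have : n * (x * 4 ^ i) <= n * n by nia.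
  rewrite leq_pmul2l => [xn|]; last by lia.
  by rewrite leq_divRL.
have i2 : i < 2 ^ i by apply: ltn_expl.
have ii2 := sqr_le_pow2 i.
rewrite -/y /h; apply: (@leq_trans (2 ^ i * (200 * 2 ^ i * y))); last by nia.
rewrite leq_mul2l; apply/orP; right.
(* The coefficient comes from [y.+1 <= 2 * y]; it is below [200 * 2 ^ i] by [ii2] and [i2]. *)
apply: (@leq_trans ((32 * (i * i) + 56 * i + 11) * y)); first by nia.
by rewrite leq_mul2r; apply/orP; right; lia.
Qed.

(** A geometric sum over scales, by induction downwards from [i >= #|V|], where no distance reaches
    4^i: 200 / 2^i + 400 / 2^(i+1) = 400 / 2^i. *)
Lemma tail_scheme i :
  exists2 s, 2 ^ i * s <= 400 * #|V| & scheme fam (fun k => 4 ^ i <= k) s.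
Proof.
have big l : #|V| < 4 ^ l -> scheme fam (fun k => 4 ^ l <= k) 0.
  move=> Vl; exists unit, (fun _ _ _ _ _ => false).
  split; first by rewrite card_unit.
  move=> e _; exists (fun=> tt) => u v k; split=> // /isd_lt_card kV lk.
  by have := leq_trans kV (ltnW (leq_trans Vl lk)); rewrite ltnn.
have [d] : exists d, #|V| <= i + d by exists #|V|; apply: leq_addl.
elim: d i => [|d IHd] i iV.
  exists 0; first by rewrite muln0.
  by apply: big; apply: leq_ltn_trans iV _; rewrite addn0 ltn_expl.
have [iV'|Vi] := leqP (4 ^ i) #|V|; last by exists 0; [rewrite muln0 | exact: big].
have [s1 c1 H1] := scale_scheme iV'.
have [|s2 c2 H2] := IHd i.+1; first by rewrite addSnnS.
exists (s1 + s2); first by move: c1 c2; rewrite expnS; nia.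
apply: scheme_union H1 H2; last by [].
by move=> k ik; have [] := ltnP k (4 ^ i.+1); [left; rewrite ik | right].
Qed.

(** * Balls explored through vertices of small out-degree *)

Section Ball.
Variables (e : rel V) (S : {set V}) (u : V) (d : nat).
Hypothesis outdeg : forall x, x \notin S -> #|[set y | e x y]| <= d.

Fixpoint ball l : {set V} :=
  if l is l'.+1 then ball l' :|: \bigcup_(x in ball l' :\: S) [set y | e x y]
  else [set u].

Lemma card_ball l : #|ball l| <= d.+1 ^ l.
Proof.
elim: l => [|l IHl] /=; first by rewrite cards1.
apply: leq_trans (leq_card_setU _ _) _; rewrite expnS mulSn.
apply: leq_add => //; apply: (@leq_trans (d * #|ball l :\: S|)).
  rewrite mulnC -sum_nat_const.
  elim/big_ind2: _ => [|x A y B Ax By|x]; first by rewrite cards0.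
    by apply: leq_trans (leq_card_setU _ _) _; apply: leq_add.
  by rewrite inE => /andP[/outdeg].
rewrite leq_mul2l; apply/orP; right; apply: leq_trans IHl.
by apply/subset_leq_card/subsetDl.
Qed.

(** A geodesic to a missed vertex avoids [S], so the exploration, which never expands vertices of
    [S], can follow it to its end. *)
Lemma missed_sub_ball c : missed e 0 c S u \subset ball c.
Proof.
apply/subsetP => v; rewrite inE => /andP[/existsP[k /= dk] /subsetP Sgeo].
have ball_wk j x : j <= k -> wk e j u x -> wk e (k - j) x v -> x \in ball j.
  elim: j x => [|j IHj] x jk; first by rewrite /= inE eq_sym.
  case/existsP=> y /andP[wy eyx] wx; have wyv : wk e (k - j) y v.
    rewrite (_ : k - j = 1 + (k - j.+1)); last by lia.
    apply: wk_trans wx; apply/existsP; exists y; by rewrite /= eqxx.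
  rewrite inE; apply/orP; right; apply/bigcupP; exists y; last by rewrite inE.
  rewrite inE IHj ?(ltnW jk) // andbT; apply/negP => /Sgeo.
  rewrite !inE => /negP; apply; apply/existsP; exists k; rewrite dk.
  have jk' : j < k.+1 by lia.
  by apply/existsP; exists (Ordinal jk'); apply/andP; split.
have ball_mono l l' : l <= l' -> ball l \subset ball l'.
  elim: l' => [|l' IHl]; first by rewrite leqn0 => /eqP ->.
  rewrite leq_eqVlt ltnS => /orP[/eqP -> //|/IHl/subset_trans]; apply.
  exact: subsetUl.
apply: (subsetP (ball_mono _ _ (ltnW (ltn_ord k)))).
apply: ball_wk (isd_wk dk) _ => //; by rewrite subnn /=.
Qed.

End Ball.

Definition sparse M (e : rel V) := #|[set p : V * V | e p.1 p.2]| <= M.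

Lemma high_degree M e d : sparse M e ->
  #|[set x | d < #|[set y | e x y]|]| * d.+1 <= M.
Proof.
apply: leq_trans.
have -> : #|[set p | e p.1 p.2]| = \sum_x #|[set y | e x y]|.
  rewrite -sum1_card (eq_bigr (fun x => \sum_(y in [set y | e x y]) 1)).
    by rewrite pair_big_dep /=; apply: eq_bigl => -[x y]; rewrite !inE.
  by move=> x _; rewrite sum1_card.
rewrite -sum_nat_const big_mkcond /=; apply: leq_sum => x _.
by rewrite inE; case: ifP.
Qed.

End Scales.

(** * Distances below a constant *)

Lemma local_scheme (m : nat -> nat) k D : growth_n_1_plus_o1 m -> 0 < k -> 0 < D ->
  exists N, forall V : finType, N <= #|V| -> exists2 s, 2 * k * s <= #|V| &
    scheme (@sparse V (2 * m #|V|)) (fun l => l < D) s.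
Proof.
move=> hm k0 D0; pose R := 8 * k; pose w' := up_log 2 (2 * R * D).
(* At most n / K hubs and n / K table entries then cost at most n / (8k) bits together; [R] bounds
   the table overhead likewise. *)
pose K := 8 * k * (2 * D + w').
(* Exponent [2 * D] gives (m/n)^(2D) <= n, so the balls have size O(sqrt n), at most n / K once
   [n >= C]. *)
have [N1 HN1] := hm (2 * D) ltac:(lia).
pose C := (8 * K) ^ (2 * D) * K ^ 2.
exists (N1 + C + 8 * k) => V; set n := #|V| => nN.
have [_ mn] := HN1 n ltac:(lia); move: mn; set mm := m n => mn.
have n0 : 0 < n by lia.
have K0 : 0 < K by rewrite /K; nia.
pose y := (2 * mm %/ n).+1; pose x := mm %/ n.
have yx : y <= 2 * x.+1.
  rewrite /y ltn_divLR //; have := ltn_ceil mm n0; rewrite -/x; lia.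
have xn : x ^ (2 * D) <= n.
  rewrite -(@leq_pmul2r (n ^ (2 * D))) ?expn_gt0 ?n0 // -expnMn.
  apply: (@leq_trans (mm ^ (2 * D))); first by rewrite expn_mono ?leq_divM.
  by move: mn; rewrite addn1 expnS.
pose d := K * y; pose t := d.+1 ^ D; pose h := n %/ K.
(* Squares are compared: (t K)^2 <= C max(x, 1)^(2D) <= C n <= n^2. The maximum covers m(n) < n,
   where [x] is 0. *)
have tn : t * K <= n.
  rewrite -leq_sqr expnMn -expnM mulnC [D * 2]mulnC.
  have d1 : d.+1 <= 8 * K * maxn x 1.
    have xm : x.+1 <= 2 * maxn x 1 by lia.
    have : K * y <= K * (2 * (2 * maxn x 1)).
      by rewrite leq_mul2l (leq_trans yx) ?orbT // leq_mul2l.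
    rewrite /d -mulnA; have : 0 < K * maxn x 1 by rewrite muln_gt0 K0; lia.
    lia.
  apply: (@leq_trans (C * maxn x 1 ^ (2 * D))).
    by rewrite /C mulnAC -expnMn mulnC leq_mul2r expn_mono ?orbT.
  apply: (@leq_trans (C * n)); last first.
    by rewrite -mulnn leq_mul2r; apply/orP; right; lia.
  rewrite leq_mul2l; apply/orP; right.
  by case: (x) xn => [|z]; rewrite ?maxnE ?exp1n ?addn0.
exists (2 * h * D + (t * w' + (n %/ R).+1)).
  have hK : h * K <= n := leq_divM _ _.
  have rR : n %/ R * R <= n := leq_divM _ _.
  have zP : maxn h t * K <= n by rewrite maxnMl geq_max hK.
  have P1 : 8 * k * (2 * h * D + t * w') <= n.
    apply: leq_trans zP; rewrite /K mulnCA leq_mul2l mulnDr; apply/orP; right.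
    by rewrite mulnAC mulnC leq_add ?leq_mul2r ?leq_maxl ?leq_maxr ?orbT.
  have k8 : 4 * (2 * k) <= n by rewrite mulnA (leq_trans _ nN) // leq_addl.
  have P4 : 4 * (2 * k * (2 * h * D + t * w')) <= n by rewrite !mulnA in P1 *.
  have R4 : 4 * (2 * k * (n %/ R)) <= n by move: rR; rewrite mulnC /R !mulnA.
  rewrite addnA mulnDr mulnS; move: k8 P4 R4.
  by move: (2 * k) (2 * k * _) (2 * k * _); clear; lia.
apply: (@hub_scheme _ _ 0 _ _ _ _ (2 * R)) => //.
- exact: ltn_expl.
- by rewrite !muln_gt0.
- by rewrite muln_gt0.
- exact: up_logP.
move=> e se; exists [set x | d < #|[set y | e x y]|]; last first.
  move=> u; apply: leq_trans (subset_leq_card (missed_sub_ball _ _ _ _)) _.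
  by apply: card_ball => z; rewrite inE -leqNgt.
(* The [z] hubs satisfy z (K y + 1) <= 2 m(n) < y n, and [y] cancels. *)
rewrite leq_divRL //; have := high_degree d se; rewrite -/mm; set z := #|_|.
have := ltn_ceil (2 * mm) n0; rewrite -/y /d => H1 H2.
rewrite -(@leq_pmul2l y) //; apply: (@leq_trans (2 * mm)); last first.
  by rewrite mulnC ltnW // mulnC.
by apply: leq_trans H2; rewrite mulnCA leq_mul2l mulnC leqnSn orbT.
Qed.

(** * Bit-string labels and the choice of one size function *)

Definition labelable n (fam : rel 'I_n -> Prop) L : Prop :=
  exists d : seq bool -> seq bool -> option nat, forall e, fam e ->
    exists lab : 'I_n -> seq bool, forall u v,
      is_dist e u v (d (lab u) (lab v)) /\ size (lab u) <= L.

(** Candidates are walk lengths and include the distance, so the least one is the distance.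
    Distances are below [#|V|], which makes the search finite; an empty search means unreachable. *)
Lemma least_is_dist (V : finType) (e : rel V) u v (c : nat -> bool) :
  (forall k, (c k -> wk e k u v) /\ (isd e k u v -> c k)) ->
  is_dist e u v (ohead [seq k <- iota 0 #|V| | c k]).
Proof.
move=> H; set s := filter _ _.
have : forall k, isd e k u v -> k \in s.
  move=> k dk; rewrite mem_filter mem_iota (isd_lt_card dk) andbT.
  by have [_ ->] := H k.
have : {in s, forall k, wk e k u v}.
  by move=> k; rewrite mem_filter => /andP[ck _]; have [->] := H k.
have : sorted leq s by apply: sorted_filter (iota_sorted _ _); exact: leq_trans.
case: s => [|k s] /= ks ws ds.
  by move=> k /wkP/wk_isd[j _ /ds].
split; first by apply/wkP/ws; rewrite inE eqxx.
move=> j jk /wkP/wk_isd[l lj /ds]; rewrite inE => /orP[/eqP|ls]; first by lia.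
by have /allP/(_ l ls) := order_path_min leq_trans ks; lia.
Qed.

(** The decoder of a scheme also reads the vertices, so each label carries its vertex in [b] extra
    bits. *)
Lemma scheme_labelable n (fam : rel 'I_n -> Prop) b s :
  n <= 2 ^ b -> scheme fam (fun=> True) s -> labelable fam (b + s).
Proof.
move=> nb [T [d [cT H]]].
have cIT : #|{: 'I_n * T}| <= #|{: (b + s).-tuple bool}|.
  by rewrite card_prod card_ord card_tuple card_bool expnD leq_mul.
pose enc (x : 'I_n * T) : seq bool := enum_val (widen_ord cIT (enum_rank x)).
have enc_inj : injective enc.
  move=> x y /val_inj/enum_val_inj /(congr1 val) /= xy.
  exact/enum_rank_inj/val_inj.
pose dec w := [pick x | enc x == w].
have encK x : dec (enc x) = Some x.
  by rewrite /dec; case: pickP => [y /eqP/enc_inj ->|/(_ x)/eqP].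
exists (fun w1 w2 => if (dec w1, dec w2) is (Some x, Some y) then
  ohead [seq k <- iota 0 #|{: 'I_n}| | d x.1 y.1 x.2 y.2 k] else None).
move=> e /H[lab L]; exists (fun u => enc (u, lab u)) => u v.
rewrite !encK /=; split; last by rewrite size_tuple.
by apply: least_is_dist => k; have [? C] := L u v k; split=> // /C; apply.
Qed.

Lemma sublinear_scheme (m : nat -> nat) k : growth_n_1_plus_o1 m -> 0 < k ->
  exists N, forall n, N <= n -> exists2 L, k * L <= n &
    labelable (@sparse 'I_n (2 * m n)) L.
Proof.
(* The budget n / k is split into n / (4k) for vertex names, n / (2k) for short distances and n /
   (4k) for the tail; the last needs 400 / 2^i <= 1 / (4k). *)
move=> hm k0; pose i := 1600 * k.
have [N HN] := local_scheme hm k0 (expn_gt0 4 i : 0 < 4 ^ i).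
(* For [b >= b0], 16 k (b + 1) <= b^2 <= 2 * 2^b, which pays for the vertex names. *)
pose b0 := 16 * k + 1.
exists (N + 2 ^ b0) => n nN; have cn := card_ord n.
have := HN 'I_n; rewrite cn => /(_ ltac:(lia))[s1 c1 H1].
have [s2] := tail_scheme (@sparse 'I_n (2 * m n)) i; rewrite cn => c2 H2.
have n0 : 0 < n by have : 0 < 2 ^ b0 by [rewrite expn_gt0]; lia.
pose b := trunc_log 2 n.
have bn : 2 ^ b <= n by apply: trunc_logP.
have b0b : b0 <= b by apply: trunc_log_max => //; lia.
have kb : 4 * k * b.+1 <= 2 ^ b.
  have : 16 * k * b.+1 <= b * b.
    apply: (@leq_trans (b.-1 * b.+1)); first by rewrite leq_mul2r; lia.
    by rewrite mulnC -{1}[b]prednK; nia.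
  by have := sqr_le_pow2 b; move: (2 ^ b) => B; nia.
have c2' : 4 * (k * s2) <= n.
  have : i < 2 ^ i by apply: ltn_expl.
  rewrite /i => iP; have : 1600 * k * s2 <= 400 * n.
    by apply: leq_trans c2; rewrite leq_mul2r ltnW ?orbT.
  lia.
exists (b.+1 + (s1 + s2)); first by lia.
apply: scheme_labelable; first exact/ltnW/trunc_log_ltn.
apply: scheme_union H1 H2; last by [].
by move=> l _; have [] := ltnP l (4 ^ i); [left | right].
Qed.

(** Makes the least size well defined at every [n], including small ones. The scales from 4^0 on
    cover all positive distances. *)
Lemma labelable_full n (fam : rel 'I_n -> Prop) : exists L, labelable fam L.
Proof.
have [s _ H] := tail_scheme fam 0.
have H0 : scheme fam (fun k => k = 0) 0.
  exists unit, (fun u v _ _ k => (u == v) && (k == 0)).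
  split; first by rewrite card_unit.
  move=> e _; exists (fun=> tt) => u v k; split; first by case/andP=> uv /eqP ->.
  by move/isd_wk => + k0; rewrite k0 eqxx andbT.
exists (n + (0 + s)); apply: scheme_labelable; first exact/ltnW/ltn_expl.
apply: scheme_union H0 H; last by [].
by case=> [|k] _; [left | right].
Qed.

Lemma labelable_sub n (fam fam' : rel 'I_n -> Prop) L :
  (forall e, fam e -> fam' e) -> labelable fam' L -> labelable fam L.
Proof. by move=> sub [d H]; exists d => e /sub/H. Qed.

(** The schemes found so far depend on [k]. Taking for [L n] the least possible size yields one
    function that is below all of them, with no diagonal choice of [k]. *)
Lemma labeling_scheme_of_sparse (m : nat -> nat)
    (fam : forall n, rel 'I_n -> Prop) :
  growth_n_1_plus_o1 m -> (forall n e, fam n e -> sparse (2 * m n) e) ->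
  exists L, little_o_n L /\ labeling_scheme_with_size fam L.
Proof.
move=> hm fam_sparse.
have least n : exists L, labelable (fam n) L /\
    forall L', labelable (fam n) L' -> L <= L'.
  have [L0 H0] := labelable_full (fam n).
  elim/ltn_ind: L0 H0 => L0 IH H0.
  have [[L [LL0 HL]]|no] := classic (exists L, L < L0 /\ labelable (fam n) L).
    exact: IH HL.
  exists L0; split=> // L' HL'; rewrite leqNgt; apply/negP => lt.
  by apply: no; exists L'.
pose L n := proj1_sig (constructive_indefinite_description _ (least n)).
have LP n : labelable (fam n) (L n) /\ forall L', labelable (fam n) L' -> L n <= L'.
  exact: (proj2_sig (constructive_indefinite_description _ (least n))).
exists L; split.
  move=> k k0; have [N HN] := sublinear_scheme hm k0.
  exists N => n /HN[s ks Hs]; apply: leq_trans ks; rewrite leq_mul2l.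
  have [_ ->] := LP n; rewrite ?orbT //.
  exact: labelable_sub (@fam_sparse n) Hs.
pose d n := proj1_sig (constructive_indefinite_description _ (proj1 (LP n))).
have dP n := proj2_sig (constructive_indefinite_description _ (proj1 (LP n))).
(* Outside the family the chosen labelling is arbitrary. *)
exists d, (fun n e => epsilon (inhabits (fun=> [::])) (fun lab : 'I_n -> seq bool =>
  forall u v, is_dist e u v (d n (lab u) (lab v)) /\ size (lab u) <= L n)).
by move=> n e fe; exact: epsilon_spec _ _ (dP n e fe).
Qed.

Lemma ugraph_sparse M n (e : rel 'I_n) : ugraph_in_family M e -> sparse (2 * M) e.
Proof.
case=> irr [sym eM]; rewrite /sparse mul2n -addnn.
set U := [set p : 'I_n * 'I_n | _ & _] in eM.
pose sw (p : 'I_n * 'I_n) := (p.2, p.1).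
apply: (@leq_trans #|U :|: sw @: U|); last first.
  apply: leq_trans (leq_card_setU _ _) _; apply: leq_add => //.
  exact: leq_trans (leq_imset_card _ _) eM.
apply/subset_leq_card/subsetP => -[x y]; rewrite !inE /= => exy.
rewrite exy; have [//|yx|/val_inj xy] := ltngtP x y; last by rewrite xy irr in exy.
by apply/imsetP; exists (y, x); rewrite // inE /= sym exy.
Qed.

Theorem theorem1 (m : nat -> nat) (hm : growth_n_1_plus_o1 m) :
  (exists L : nat -> nat, little_o_n L /\
     labeling_scheme_with_size (fun n e => ugraph_in_family (m n) e) L) /\
  (exists L : nat -> nat, little_o_n L /\
     labeling_scheme_with_size (fun n e => dgraph_in_family (m n) e) L).
Proof.
split; apply: (labeling_scheme_of_sparse hm) => n e.
  exact: ugraph_sparse.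
by case=> _ eM; apply: leq_trans eM _; apply: leq_pmull.
Qed.
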